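(* Let $z>0$, $0<w_N<w_I\le z/2$, $d:=w_I-w_N$, $i>0$, $n_n>n_h>0$, and set $c_h:=i+n_h$, $c_n:=i+n_n$, $C:=c_h+c_n$, $\bar\delta:=\frac{i(n_n-n_h)}{2(i+n_n)}$. Let $D(b)=b\log\cosh\left(\frac{z}{2b}\right)$ for $b>0$, let $b_0>0$ be the unique number with $D(b_0)=w_N$, and let $a(b):=w_N-D(b)>0$ for $b>b_0$. Fix $\underline b>b_0$ and $\Lambda$ with $$0<\Lambda<\bar\delta\,a(\underline b),$$ and consider, for $m>0$ and $b\ge\underline b$, the directional (SCF) and uniform programs with fixed per-arrival loss allowance $m\Lambda$ defined in the context. Then for every $m>0$ and $b\ge\underline b$ the unique optimizer of the directional program is $$\ell_h^{D,\Lambda}(b)=0,\qquad \ell_n^{D,\Lambda}(b)=\frac{\Lambda}{i},$$ and the unique optimizer of the uniform program is $$\ell^{U,\Lambda}(b)=\frac{\Lambda}{2i}.$$ The optimal values divided by $m$ are $$G_D^{\Lambda}(b)=d\Lambda+c_n\frac{\Lambda}{i}\left(a(b)-\frac{\Lambda}{i}\right),\qquad G_U^{\Lambda}(b)=d\Lambda+C\frac{\Lambda}{2i}\left(a(b)-\frac{\Lambda}{2i}\right),$$ and $0<G_U^{\Lambda}(b)<G_D^{\Lambda}(b)$ for every $b\ge\underline b$. For $M\in\{D,U\}$ and $m>0$ set $$S_M^{\Lambda}:=\max_{b\ge\underline b}\frac{G_M^{\Lambda}(b)}{b\log 2},\qquad \mathcal{B}_M^{\Lambda}(m):=\{b\ge\underline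 b:\ mG_M^{\Lambda}(b)\ge b\log 2\}.$$ Then (the maxima exist and) $0<S_U^{\Lambda}<S_D^{\Lambda}<\infty$, and: (i) if $0<m<1/S_D^{\Lambda}$, then $\mathcal{B}_D^{\Lambda}(m)=\mathcal{B}_U^{\Lambda}(m)=\varnothing$; (ii) if $1/S_D^{\Lambda}\le m<1/S_U^{\Lambda}$, then $\mathcal{B}_D^{\Lambda}(m)\neq\varnothing$ and $\mathcal{B}_U^{\Lambda}(m)=\varnothing$; (iii) if $m\ge 1/S_U^{\Lambda}$, then $\mathcal{B}_U^{\Lambda}(m)\subsetneq\mathcal{B}_D^{\Lambda}(m)$.
   Context: Setting: a binary logarithmic market scoring rule (LMSR) market with liquidity parameter $b>0$. $D(b)$ is the cost of a fixed lot of risky size $z$ in either payoff direction $s\in\{h,n\}$ from the symmetric initial state, and $b\log 2$ is the prefunded seed capital. The function $D$ is continuous and strictly decreasing on $(0,\infty)$ with limits $z/2$ at $0$ and $0$ at $\infty$, so $b_0$ is well defined and $a(b)>0$ for $b>b_0$. At arrival scale $m>0$, with levy $\ell_s\in[0,a(b)]$ in direction $s\in\{h,n\}$, the executed demands of informed ($\mathrm{I}$) and noise ($\mathrm{N}$) orders are $$Q_{\mathrm{I},s}=m\,i\,[a(b)+d-\ell_s],\qquad Q_{\mathrm{N},s}=m\,n_s\,[a(b)-\ell_s].$$ Expected levy revenue is $$\Gamma(\ell_h,\ell_n;b,m)=\sum_{s\in\{h,n\}}\ell_s\,[Q_{\mathrm{I},s}+Q_{\mathrm{N},s}]=m\sum_{s\in\{h,n\}}\Big(i\,d\,\ell_s+c_s\ell_s[a(b)-\ell_s]\Big).$$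 The expected number of informed orders screened out in direction $s$ is $m\,i\,\ell_s$; the total allowed is $m\Lambda$, the same for all $b$. Directional (SCF) program: maximize $\Gamma(\ell_h,\ell_n;b,m)$ subject to $i(\ell_h+\ell_n)\le\Lambda$ and $0\le\ell_h,\ell_n\le a(b)$. Uniform program: maximize $\Gamma(\ell,\ell;b,m)$ subject to $2i\ell\le\Lambda$ and $0\le\ell\le a(b)$. The labels $D$ and $U$ as subscripts/superscripts on $G,S,\mathcal{B},\ell$ stand for ''directional'' and ''uniform'' (not the function $D(b)$). *)

(* Defs.v *)
From Stdlib Require Import Reals.
Open Scope R_scope.

Definition maximizes {T : Type} (feasible : T -> Prop) (obj : T -> R) (x : T) : Prop :=
  feasible x /\ forall y, feasible y -> obj y <= obj x.

Definition is_max_value {T : Type} (feasible : T -> Prop) (obj : T -> R) (v : R) : Prop :=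
  exists x, maximizes feasible obj x /\ obj x = v.

(** Change of the logarithmic market scoring rule cost
    [b * ln (exp (q_h / b) + exp (q_n / b))] from [(0, 0)] to [(z / 2, - z / 2)];
    by symmetry it does not depend on the direction. Meaningful for [0 < b] only. *)
Definition lot_cost (z b : R) : R := b * ln (cosh (z / (2 * b))).

(** The largest levy that leaves noise demand nonnegative. *)
Definition noise_margin (z w_N b : R) : R := w_N - lot_cost z b.

(** Below, [a] stands for the value of [noise_margin] at the liquidity under
    consideration, and the subscripts [h] and [n] are the two payoff directions. *)

Definition informed_demand (m i d a l : R) : R := m * i * (a + d - l).

Definition noise_demand (m n_s a l : R) : R := m * n_s * (a - l).

Definition levy_revenue (i n_h n_n d a m l_h l_n : R) : R :=
  l_h * (informed_demand m i d a l_h + noise_demand m n_h a l_h) +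
  l_n * (informed_demand m i d a l_n + noise_demand m n_n a l_n).

(** A directional levy is the pair [(l_h, l_n)]. *)

Definition directional_feasible (i Lambda a : R) (l : R * R) : Prop :=
  i * (fst l + snd l) <= Lambda /\ 0 <= fst l <= a /\ 0 <= snd l <= a.

Definition directional_objective (i n_h n_n d a m : R) (l : R * R) : R :=
  levy_revenue i n_h n_n d a m (fst l) (snd l).

Definition uniform_feasible (i Lambda a l : R) : Prop :=
  2 * i * l <= Lambda /\ 0 <= l <= a.

Definition uniform_objective (i n_h n_n d a m l : R) : R :=
  levy_revenue i n_h n_n d a m l l.

(** Liquidities from [b_lo] up whose revenue [m * G b] covers the seed capital
    [b * ln 2]. *)
Definition funded_set (G : R -> R) (b_lo m b : R) : Prop :=
  b_lo <= b /\ m * G b >= b * ln 2.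

(* Main.v *)
Require Import Defs.
From Stdlib Require Import Reals Ranalysis5 Lra.
Open Scope R_scope.

(** With [x = z / (2 b)] the lot cost is [z / 2] times the slope of the chord of
    [ln cosh] over [[0, x]], and [ln cosh] is convex with derivative [tanh]; this
    gives monotonicity in [b], and the intermediate value theorem gives [b0].
    As the cap [Lambda] is below [delta * a], both programs are increasing up to
    the cap and one unit of screening is worth more in direction [n] than in
    direction [h], which fixes the optimizers and [G_U < G_D]. Both values are
    bounded, so their ratios to the seed capital decay and attain their maxima;
    [G_U < G_D] at a maximizer for [U] orders the thresholds. For the strict
    inclusion, at a liquidity where [D] exactly breaks even, [U] is not funded. *)

(** * Monotonicity of [tanh]; convexity and bounds for [ln cosh] *)

Lemma tanh_exp (x : R) : sinh x / cosh x = 1 - 2 / (exp (2 * x) + 1).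
Proof.
  unfold sinh, cosh.
  replace (2 * x) with (x + x) by ring.
  rewrite exp_plus, exp_Ropp.
  pose proof (exp_pos x).
  field. repeat split; nra.
Qed.

(** In the form given by [tanh_exp] the variable occurs only once, in a denominator that grows with
    it. *)
Lemma tanh_increasing (x y : R) : x < y -> sinh x / cosh x < sinh y / cosh y.
Proof.
  intro hxy. rewrite !tanh_exp.
  pose proof (exp_pos (2 * x)).
  assert (exp (2 * x) < exp (2 * y)) by (apply exp_increasing; lra).
  assert (/ (exp (2 * y) + 1) < / (exp (2 * x) + 1)).
  { apply Rinv_lt_contravar; nra. }
  unfold Rdiv. lra.
Qed.

Lemma cosh_pos (x : R) : 0 < cosh x.
Proof. unfold cosh. pose proof (exp_pos x). pose proof (exp_pos (- x)). lra. Qed.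

Lemma derivable_pt_lim_ln_cosh (x : R) :
  derivable_pt_lim (fun t => ln (cosh t)) x (sinh x / cosh x).
Proof.
  replace (sinh x / cosh x) with (/ cosh x * sinh x) by (unfold Rdiv; ring).
  apply (derivable_pt_lim_comp cosh ln).
  - apply derivable_pt_lim_cosh.
  - apply derivable_pt_lim_ln, cosh_pos.
Qed.

Lemma ln_cosh_mean_value (x y : R) : x < y -> exists c : R,
  x < c < y /\ ln (cosh y) - ln (cosh x) = sinh c / cosh c * (y - x).
Proof.
  intro hxy.
  destruct (MVT_cor2 (fun t => ln (cosh t)) (fun t => sinh t / cosh t) x y hxy)
    as [c [he hc]].
  - intros c _. apply derivable_pt_lim_ln_cosh.
  - exists c. split; assumption.
Qed.

Lemma ln_cosh_0 : ln (cosh 0) = 0.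
Proof. rewrite cosh_0. apply ln_1. Qed.

Lemma ln_cosh_mean_value_0 (x : R) : 0 < x -> exists c : R,
  0 < c < x /\ ln (cosh x) = sinh c / cosh c * x.
Proof.
  intro hx. destruct (ln_cosh_mean_value 0 x hx) as [c [hc he]].
  rewrite ln_cosh_0 in he. exists c. split; lra.
Qed.

Lemma ln_cosh_pos (x : R) : 0 < x -> 0 < ln (cosh x).
Proof.
  intro hx. destruct (ln_cosh_mean_value_0 x hx) as [c [hc ->]].
  pose proof (tanh_increasing 0 c (proj1 hc)) as ht.
  rewrite sinh_0 in ht. unfold Rdiv at 1 in ht. nra.
Qed.

(** Since [ln cosh] vanishes at 0, this compares chord slopes from the origin. The mean slope over
    [[0, x]] is [tanh] at a smaller point than the mean slope over [[x, y]]. *)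
Lemma ln_cosh_convex (x y : R) : 0 < x < y -> y * ln (cosh x) < x * ln (cosh y).
Proof.
  intros [hx hxy].
  destruct (ln_cosh_mean_value_0 x hx) as [c [hc h1]].
  destruct (ln_cosh_mean_value x y hxy) as [c' [hc' h2]].
  assert (ht : sinh c / cosh c < sinh c' / cosh c') by (apply tanh_increasing; lra).
  set (t := sinh c / cosh c) in *. set (t' := sinh c' / cosh c') in *.
  (* This product is the right side of the goal minus the left. *)
  assert (0 < x * (y - x) * (t' - t)) by
    (apply Rmult_lt_0_compat; [apply Rmult_lt_0_compat|]; lra).
  replace (ln (cosh y)) with (t * x + t' * (y - x)) by lra.
  rewrite h1. lra.
Qed.

(** Drop the term [exp (- x)] from [2 * cosh x]. *)
Lemma ln_cosh_lower (x : R) : x - ln 2 < ln (cosh x).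
Proof.
  assert (he : x - ln 2 = ln (exp x / 2)).
  { unfold Rdiv. rewrite ln_mult, ln_exp, ln_Rinv; try lra. apply exp_pos. }
  rewrite he. pose proof (exp_pos x). pose proof (exp_pos (- x)).
  apply ln_increasing; unfold cosh; lra.
Qed.

(** The mean slope is [(u - 1) / (u + 1)] with [u = exp (2 * c)], hence below [u - 1]. The bound is
    crude, but a logarithm solves explicitly for the point where its factor takes a given value. *)
Lemma ln_cosh_upper (x : R) : 0 < x -> ln (cosh x) < (exp (2 * x) - 1) * x.
Proof.
  intro hx. destruct (ln_cosh_mean_value_0 x hx) as [c [hc ->]].
  apply Rmult_lt_compat_r; [lra|]. rewrite tanh_exp.
  assert (1 < exp (2 * c)) by (rewrite <- exp_0; apply exp_increasing; lra).
  assert (exp (2 * c) < exp (2 * x)) by (apply exp_increasing; lra).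
  set (u := exp (2 * c)) in *.
  replace (1 - 2 / (u + 1)) with ((u - 1) * / (u + 1)) by (field; lra).
  assert (/ (u + 1) < 1) by (rewrite <- Rinv_1; apply Rinv_lt_contravar; lra).
  assert (0 < / (u + 1)) by (apply Rinv_0_lt_compat; lra).
  nra.
Qed.

(** * The lot cost as a function of liquidity *)

Section LotCost.
Variable z : R.
Hypothesis hz : 0 < z.

Lemma half_lot_pos (b : R) : 0 < b -> 0 < z / (2 * b).
Proof. intro hb. apply Rdiv_lt_0_compat; lra. Qed.

Lemma lot_cost_pos (b : R) : 0 < b -> 0 < lot_cost z b.
Proof.
  intro hb. apply Rmult_lt_0_compat; [assumption|].
  apply ln_cosh_pos, half_lot_pos, hb.
Qed.

Lemma lot_cost_decreasing (b b' : R) :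
  0 < b -> b < b' -> lot_cost z b' < lot_cost z b.
Proof.
  intros hb hbb'. unfold lot_cost.
  assert (hx : z / (2 * b') < z / (2 * b)).
  { apply Rmult_lt_compat_l; [assumption|]. apply Rinv_lt_contravar; nra. }
  assert (hc : z / (2 * b) * ln (cosh (z / (2 * b')))
               < z / (2 * b') * ln (cosh (z / (2 * b)))).
  { apply ln_cosh_convex; split; [apply half_lot_pos; lra | assumption]. }
  set (u := ln (cosh (z / (2 * b)))) in *.
  set (u' := ln (cosh (z / (2 * b')))) in *.
  (* This factor turns the prefactors [b'] and [b] into the arguments [z / (2 * b)] and
     [z / (2 * b')], as in [hc]. *)
  apply (Rmult_lt_reg_l (z / (2 * b * b'))).
  - apply Rdiv_lt_0_compat; nra.
  - replace (z / (2 * b * b') * (b' * u')) with (z / (2 * b) * u') by (field; lra).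
    replace (z / (2 * b * b') * (b * u)) with (z / (2 * b') * u) by (field; lra).
    assumption.
Qed.

Lemma lot_cost_continuous (b : R) : 0 < b -> continuity_pt (lot_cost z) b.
Proof.
  intro hb. unfold lot_cost.
  apply (continuity_pt_mult (fun b => b) (fun b => ln (cosh (z / (2 * b))))).
  - apply derivable_continuous_pt, derivable_pt_id.
  - apply (continuity_pt_comp (fun b => z / (2 * b)) (fun t => ln (cosh t))).
    + apply derivable_continuous_pt. unfold Rdiv.
      apply (derivable_pt_mult (fun _ => z) (fun b => / (2 * b))).
      * apply derivable_pt_const.
      * apply (derivable_pt_inv (fun b => 2 * b)); [lra|].
        apply derivable_pt_scal, derivable_pt_id.
    + apply derivable_continuous_pt. eexists. apply derivable_pt_lim_ln_cosh.
Qed.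

(** The two bracketing points come from [z / 2 - b * ln 2 < lot_cost z b] and
    [lot_cost z b < z / 2 * (exp (z / b) - 1)]. *)
Lemma lot_cost_surjective (w : R) :
  0 < w < z / 2 -> exists b : R, 0 < b /\ lot_cost z b = w.
Proof.
  intros [hw hwz].
  pose proof ln_lt_2 as hl2.
  assert (hl : 0 < ln (1 + 2 * w / z)).
  { rewrite <- ln_1. apply ln_increasing; [lra|].
    assert (0 < 2 * w / z) by (apply Rdiv_lt_0_compat; lra). lra. }
  (* At [b1] the lower bound equals [w], and at [b2] the upper bound does. *)
  set (b1 := (z / 2 - w) / ln 2).
  set (b2 := z / ln (1 + 2 * w / z)).
  assert (hb1 : 0 < b1) by (apply Rdiv_lt_0_compat; lra).
  assert (hb2 : 0 < b2) by (apply Rdiv_lt_0_compat; lra).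
  assert (h1 : w < lot_cost z b1).
  { pose proof (ln_cosh_lower (z / (2 * b1))) as h.
    apply (Rmult_lt_compat_l b1) in h; [|assumption].
    unfold lot_cost. eapply Rle_lt_trans; [|exact h].
    right. unfold b1 in *. field. lra. }
  assert (h2 : lot_cost z b2 < w).
  { pose proof (ln_cosh_upper (z / (2 * b2)) (half_lot_pos b2 hb2)) as h.
    apply (Rmult_lt_compat_l b2) in h; [|assumption].
    unfold lot_cost. eapply Rlt_le_trans; [exact h|].
    right. replace (2 * (z / (2 * b2))) with (ln (1 + 2 * w / z)).
    - rewrite exp_ln; [field; lra|].
      assert (0 < 2 * w / z) by (apply Rdiv_lt_0_compat; lra). lra.
    - unfold b2. field. lra. }
  assert (h12 : b1 < b2).
  { destruct (Rlt_le_dec b1 b2) as [|[hlt|heq]]; [assumption| |].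
    - pose proof (lot_cost_decreasing b2 b1 hb2 hlt). lra.
    - rewrite heq in h2. lra. }
  destruct (IVT_interv (fun b => w - lot_cost z b) b1 b2) as [b [hb hb0]].
  - intros c hc.
    apply (continuity_pt_minus (fun _ => w) (lot_cost z)).
    + apply continuity_pt_const. intros ? ?. reflexivity.
    + apply lot_cost_continuous. lra.
  - assumption.
  - lra.
  - lra.
  - exists b. split; lra.
Qed.

End LotCost.

(** * Optimal levies at a fixed liquidity *)

Section Programs.
(** [L] is [Lambda / i], the cap on the total levy; [hLa] is [Lambda < delta * a] with denominators
    cleared. *)
Variables i n_h n_n d a m L : R.
Hypothesis hi : 0 < i.
Hypothesis hnh : 0 < n_h.
Hypothesis hnn : n_h < n_n.
Hypothesis hd : 0 < d.
Hypothesis hm : 0 < m.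
Hypothesis hL : 0 < L.
Hypothesis hLa : 2 * (i + n_n) * L < (n_n - n_h) * a.

(** Follows from [n_n - n_h < i + n_n]. It keeps all admissible levies on the increasing branch of
    [l * (a - l)]. *)
Lemma levy_cap_below_half : 2 * L < a.
Proof. nra. Qed.

Lemma levy_revenue_split (l_h l_n : R) :
  levy_revenue i n_h n_n d a m l_h l_n =
  m * (i * d * (l_h + l_n) + (i + n_h) * (l_h * (a - l_h))
       + (i + n_n) * (l_n * (a - l_n))).
Proof. unfold levy_revenue, informed_demand, noise_demand. ring. Qed.

(** Two moves lead from [(x, y)] to [(0, L)]: raise [y] to [L - x], then shift [x] from direction
    [h] to direction [n]. The disjunction yields optimality and uniqueness together. *)
Lemma directional_revenue_lt (x y : R) :
  0 <= x -> 0 <= y -> x + y <= L ->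
  (x, y) = (0, L) \/ levy_revenue i n_h n_n d a m x y < levy_revenue i n_h n_n d a m 0 L.
Proof.
  intros hx hy hxy. pose proof levy_cap_below_half as hL2.
  assert (hdec : (x, y) = (0, L) \/ x <> 0 \/ y <> L).
  { destruct (Req_dec x 0) as [->|]; [|tauto].
    destruct (Req_dec y L) as [->|]; tauto. }
  destruct hdec as [heq|hne]; [left; assumption | right].
  rewrite !levy_revenue_split. apply Rmult_lt_compat_l; [assumption|].
  assert (h1 : i * d * (x + y) <= i * d * (0 + L)).
  { apply Rmult_le_compat_l; nra. }
  (* Gain of the quadratic term in direction [n] from the first move. *)
  assert (h2 : 0 <= (i + n_n) * ((L - x - y) * (a - (L - x) - y))).
  { repeat apply Rmult_le_pos; lra. }
  destruct (Req_dec x 0) as [->|hx0].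
  - assert (hyL : y <> L) by (destruct hne as [[]|]; tauto).
    assert (0 < (i + n_n) * ((L - y) * (a - L - y))).
    { repeat apply Rmult_lt_0_compat; lra. }
    lra.
  (* Net gain of the quadratic terms from the second move, positive by [hLa]. *)
  - assert (0 < x * ((n_n - n_h) * a - 2 * (i + n_n) * L + (2 * i + n_h + n_n) * x)).
    { apply Rmult_lt_0_compat; nra. }
    lra.
Qed.

Lemma uniform_revenue_lt (l : R) :
  0 <= l -> 2 * l <= L ->
  l = L / 2 \/ levy_revenue i n_h n_n d a m l l < levy_revenue i n_h n_n d a m (L / 2) (L / 2).
Proof.
  intros hl hlL. pose proof levy_cap_below_half as hL2.
  destruct (Req_dec l (L / 2)) as [heq|hne]; [left; assumption | right].
  rewrite !levy_revenue_split. apply Rmult_lt_compat_l; [assumption|].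
  assert (0 < L / 2 - l) by lra.
  assert (0 < i * d * (L / 2 - l)) by (repeat apply Rmult_lt_0_compat; lra).
  assert (0 < (2 * i + n_h + n_n) * ((L / 2 - l) * (a - L / 2 - l))).
  { repeat apply Rmult_lt_0_compat; lra. }
  lra.
Qed.

End Programs.

Lemma unique_maximizer {T : Type} (feasible : T -> Prop) (obj : T -> R) (x : T) :
  feasible x -> (forall y, feasible y -> y = x \/ obj y < obj x) ->
  unique (maximizes feasible obj) x.
Proof.
  intros hx hlt. split.
  - split; [assumption|]. intros y hy.
    destruct (hlt y hy) as [->|h]; [right; reflexivity | left; exact h].
  - intros y [hy hmax]. destruct (hlt y hy) as [->|h]; [reflexivity|].
    specialize (hmax x hx). lra.
Qed.

(** * Covering the seed capital out of a bounded positive value *)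

Section Funding.
Variables (G : R -> R) (b_lo K : R).
Hypothesis hb_lo : 0 < b_lo.
Hypothesis hcont : forall b, b_lo <= b -> continuity_pt G b.
Hypothesis hpos : forall b, b_lo <= b -> 0 < G b.
Hypothesis hK : forall b, b_lo <= b -> G b <= K.

Definition funding_ratio (b : R) : R := G b / (b * ln 2).

Lemma seed_pos (b : R) : b_lo <= b -> 0 < b * ln 2.
Proof. intro hb. pose proof ln_lt_2. nra. Qed.

Lemma funding_ratio_pos (b : R) : b_lo <= b -> 0 < funding_ratio b.
Proof. intro hb. apply Rdiv_lt_0_compat; [apply hpos | apply seed_pos]; assumption. Qed.

(** The ratio is at most [K / (b * ln 2)], so beyond some [M] it cannot exceed its value at [b_lo];
    on [[b_lo, M]] continuity gives the maximum. *)
Lemma funding_ratio_max :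
  exists b, maximizes (fun b => b_lo <= b) funding_ratio b.
Proof.
  pose proof ln_lt_2 as hl2.
  pose proof (funding_ratio_pos b_lo (Rle_refl _)) as hr0.
  assert (hK0 : 0 < K).
  { eapply Rlt_le_trans; [apply hpos | apply hK]; apply Rle_refl. }
  set (r0 := funding_ratio b_lo) in *.
  (* The second summand is where [K / (b * ln 2)] equals [r0]; adding [b_lo] places [M] to the right
     of [b_lo]. *)
  set (M := b_lo + K / (r0 * ln 2)).
  assert (hr0l : 0 < r0 * ln 2) by nra.
  assert (hM : 0 < K / (r0 * ln 2)) by (apply Rdiv_lt_0_compat; lra).
  destruct (continuity_ab_maj funding_ratio b_lo M) as [b [hb hbM]].
  - unfold M. lra.
  - intros c [hc _]. apply (continuity_pt_div G (fun b => b * ln 2)).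
    + apply hcont, hc.
    + apply derivable_continuous_pt.
      apply (derivable_pt_mult (fun b => b) (fun _ => ln 2)).
      * apply derivable_pt_id.
      * apply derivable_pt_const.
    + apply Rgt_not_eq, seed_pos, hc.
  - exists b. split; [apply hbM|]. intros y hy.
    destruct (Rle_lt_dec y M) as [hyM|hyM]; [apply hb; lra|].
    apply Rle_trans with r0; [|apply hb; unfold M; lra].
    unfold funding_ratio. pose proof (seed_pos y hy) as hsy.
    apply (Rmult_le_reg_r (y * ln 2)); [assumption|].
    replace (G y / (y * ln 2) * (y * ln 2)) with (G y) by (field; split; lra).
    apply Rle_trans with K; [apply hK, hy|].
    assert (hKM : K <= M * (r0 * ln 2)).
    { unfold M. replace ((b_lo + K / (r0 * ln 2)) * (r0 * ln 2))
        with (b_lo * (r0 * ln 2) + K) by (field; split; lra). nra. }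
    assert (M * (r0 * ln 2) <= y * (r0 * ln 2)) by nra. lra.
Qed.

(** Funded sets become superlevel sets of one ratio, so its maximum decides whether they are
    empty. *)
Lemma funded_iff (m b : R) : 0 < m ->
  funded_set G b_lo m b <-> b_lo <= b /\ 1 / m <= funding_ratio b.
Proof.
  intro hm. unfold funded_set.
  assert (he : b_lo <= b -> m * G b - b * ln 2
                 = (funding_ratio b - 1 / m) * (m * (b * ln 2))).
  { intro hb. pose proof (seed_pos b hb). pose proof ln_lt_2.
    unfold funding_ratio. field. repeat split; lra. }
  split; intros [hb h]; split; try assumption; specialize (he hb);
    pose proof (Rmult_lt_0_compat _ _ hm (seed_pos b hb)); nra.
Qed.

(** [m * G] is bounded while the seed capital is not, so the intermediate value
    theorem yields a break-even liquidity beyond any strictly funded one. *)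
Lemma funded_break_even (m b1 : R) : 0 < m -> b_lo <= b1 -> b1 * ln 2 < m * G b1 ->
  exists b, b_lo <= b /\ m * G b = b * ln 2.
Proof.
  intros hm hb1 h1. pose proof ln_lt_2 as hl2.
  (* At [M] the seed capital is [m * K + ln 2], more than [m * G] can reach. *)
  set (M := (m * K) / ln 2 + 1).
  assert (hMl : M * ln 2 = m * K + ln 2) by (unfold M; field; lra).
  pose proof (hK b1 hb1) as hK1.
  assert (hmK : m * G b1 <= m * K) by nra.
  assert (hbM : b1 < M) by nra.
  destruct (IVT_interv (fun b => b * ln 2 - m * G b) b1 M) as [b [hb hb0]].
  - intros c hc.
    apply (continuity_pt_minus (fun b => b * ln 2) (fun b => m * G b)).
    + apply derivable_continuous_pt.
      apply (derivable_pt_mult (fun b => b) (fun _ => ln 2)).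
      * apply derivable_pt_id.
      * apply derivable_pt_const.
    + apply (continuity_pt_scal G m). apply hcont. lra.
  - assumption.
  - lra.
  - assert (hGM : G M <= K) by (apply hK; lra).
    assert (m * G M <= m * K) by nra. lra.
  - exists b. split; lra.
Qed.

End Funding.

(** * Continuity of the optimal values and comparison of the two thresholds *)

Lemma noise_margin_continuous (z w b : R) :
  0 < z -> 0 < b -> continuity_pt (noise_margin z w) b.
Proof.
  intros hz hb. apply (continuity_pt_minus (fun _ => w) (lot_cost z)).
  - apply continuity_pt_const. intros ? ?. reflexivity.
  - apply lot_cost_continuous; assumption.
Qed.

(** The common shape of [G_D] and [G_U], with the noise margin as [f]. *)
Lemma affine_continuous (f : R -> R) (p q r b : R) :
  continuity_pt f b -> continuity_pt (fun b => p + q * (f b - r)) b.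
Proof.
  intro hf.
  apply (continuity_pt_plus (fun _ => p) (fun b => q * (f b - r))).
  - apply continuity_pt_const. intros ? ?. reflexivity.
  - apply (continuity_pt_scal (fun b => f b - r) q).
    apply (continuity_pt_minus f (fun _ => r)); [assumption|].
    apply continuity_pt_const. intros ? ?. reflexivity.
Qed.

Lemma funding_thresholds (G_D G_U : R -> R) (b_lo K : R) :
  0 < b_lo ->
  (forall b, b_lo <= b -> continuity_pt G_D b) ->
  (forall b, b_lo <= b -> continuity_pt G_U b) ->
  (forall b, b_lo <= b -> 0 < G_U b < G_D b) ->
  (forall b, b_lo <= b -> G_D b <= K) ->
  exists S_D S_U : R,
    is_max_value (fun b => b_lo <= b) (funding_ratio G_D) S_D /\
    is_max_value (fun b => b_lo <= b) (funding_ratio G_U) S_U /\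
    0 < S_U < S_D /\
    (forall m, 0 < m < 1 / S_D ->
      (forall b, ~ funded_set G_D b_lo m b) /\
      (forall b, ~ funded_set G_U b_lo m b)) /\
    (forall m, 1 / S_D <= m < 1 / S_U ->
      (exists b, funded_set G_D b_lo m b) /\
      (forall b, ~ funded_set G_U b_lo m b)) /\
    (forall m, 1 / S_U <= m ->
      (forall b, funded_set G_U b_lo m b -> funded_set G_D b_lo m b) /\
      (exists b, funded_set G_D b_lo m b /\ ~ funded_set G_U b_lo m b)).
Proof.
  intros hb hcD hcU hUD hK.
  assert (hposD : forall b, b_lo <= b -> 0 < G_D b)
    by (intros b h; specialize (hUD b h); lra).
  assert (hposU : forall b, b_lo <= b -> 0 < G_U b)
    by (intros b h; specialize (hUD b h); lra).
  assert (hKU : forall b, b_lo <= b -> G_U b <= K)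
    by (intros b h; specialize (hUD b h); specialize (hK b h); lra).
  destruct (funding_ratio_max G_D b_lo K hb hcD hposD hK) as [bD [hbD hmaxD]].
  destruct (funding_ratio_max G_U b_lo K hb hcU hposU hKU) as [bU [hbU hmaxU]].
  pose proof (funding_ratio_pos G_U b_lo hb hposU bU hbU) as hSU.
  assert (hlt : funding_ratio G_U bU < funding_ratio G_D bD).
  { apply Rlt_le_trans with (funding_ratio G_D bU); [|apply hmaxD, hbU].
    apply Rmult_lt_compat_r; [|apply hUD, hbU].
    apply Rinv_0_lt_compat, (seed_pos b_lo hb bU hbU). }
  exists (funding_ratio G_D bD), (funding_ratio G_U bU).
  set (S_D := funding_ratio G_D bD) in *. set (S_U := funding_ratio G_U bU) in *.
  assert (hinv : forall m s, 0 < m -> 0 < s -> m < 1 / s -> s < 1 / m).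
  { intros m s hm hs h. apply (Rmult_lt_compat_r s) in h; [|assumption].
    replace (1 / s * s) with 1 in h by (field; lra).
    apply (Rmult_lt_reg_r m); [assumption|].
    replace (1 / m * m) with 1 by (field; lra). lra. }
  assert (hinv' : forall m s, 0 < s -> 1 / s <= m -> 0 < m /\ 1 / m <= s).
  { intros m s hs h.
    assert (hm : 0 < m) by (assert (0 < 1 / s) by (apply Rdiv_lt_0_compat; lra); lra).
    split; [assumption|]. apply (Rmult_le_compat_r s) in h; [|lra].
    replace (1 / s * s) with 1 in h by (field; lra).
    apply (Rmult_le_reg_r m); [assumption|].
    replace (1 / m * m) with 1 by (field; lra). lra. }
  assert (hemptyU : forall m, 0 < m -> m < 1 / S_U ->
            forall b, ~ funded_set G_U b_lo m b).
  { intros m hm hmS b hf. apply (funded_iff G_U b_lo hb m b hm) in hf.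
    destruct hf as [hbb hf]. specialize (hmaxU b hbb).
    specialize (hinv m S_U hm hSU hmS). lra. }
  assert (hemptyD : forall m, 0 < m -> m < 1 / S_D ->
            forall b, ~ funded_set G_D b_lo m b).
  { intros m hm hmS b hf. apply (funded_iff G_D b_lo hb m b hm) in hf.
    destruct hf as [hbb hf]. specialize (hmaxD b hbb).
    assert (S_D < 1 / m) by (apply hinv; lra). lra. }
  split; [exists bD; repeat split; assumption|].
  split; [exists bU; repeat split; assumption|].
  split; [split; assumption|].
  split; [|split].
  - intros m [hm hmS]. split; [apply hemptyD; assumption|].
    apply hemptyU; [assumption|].
    apply Rlt_trans with (1 / S_D); [assumption|].
    apply Rmult_lt_compat_l; [lra|]. apply Rinv_lt_contravar; nra.
  - intros m [hm hmS].
    destruct (hinv' m S_D) as [hm0 hmD]; [lra | assumption |].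
    split; [|apply hemptyU; assumption].
    exists bD. apply funded_iff; try assumption. split; assumption.
  - intros m hmS. destruct (hinv' m S_U hSU hmS) as [hm hmU].
    split.
    { intros b [hbb hf]. specialize (hUD b hbb). split; [assumption | nra]. }
    assert (hfU : funded_set G_U b_lo m bU)
      by (apply funded_iff; try assumption; split; assumption).
    destruct hfU as [_ hfU]. pose proof (hUD bU hbU) as hUDb.
    (* [U] is funded at [bU], so [D] is strictly funded there and breaks even at some [b], where
       [G_U b < G_D b] leaves [U] short. *)
    destruct (funded_break_even G_D b_lo K hcD hK m bU hm hbU) as [b [hbb he]];
      [nra|].
    exists b. specialize (hUD b hbb).
    unfold funded_set. split; [split; [assumption | lra]|].
    intros [_ h]. nra.
Qed.

Theorem proposition7 (z w_N w_I i n_h n_n : R)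
  (hz : 0 < z) (hwN : 0 < w_N) (hwNI : w_N < w_I) (hwI : w_I <= z / 2)
  (hi : 0 < i) (hnh : 0 < n_h) (hnn : n_h < n_n) :
  let d := w_I - w_N in
  let c_h := i + n_h in
  let c_n := i + n_n in
  let C := c_h + c_n in
  let delta := i * (n_n - n_h) / (2 * (i + n_n)) in
  let a := noise_margin z w_N in
  exists b0 : R,
    unique (fun b => 0 < b /\ lot_cost z b = w_N) b0 /\
    (forall b, b0 < b -> 0 < a b) /\
    forall b_lo Lambda : R,
      b0 < b_lo -> 0 < Lambda -> Lambda < delta * a b_lo ->
      let G_D := fun b => d * Lambda + c_n * (Lambda / i) * (a b - Lambda / i) in
      let G_U := fun b => d * Lambda + C * (Lambda / (2 * i)) * (a b - Lambda / (2 * i)) in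
      let B_D := funded_set G_D b_lo in
      let B_U := funded_set G_U b_lo in
      (forall m b, 0 < m -> b_lo <= b ->
        let feas_D := directional_feasible i Lambda (a b) in
        let obj_D := directional_objective i n_h n_n d (a b) m in
        let feas_U := uniform_feasible i Lambda (a b) in
        let obj_U := uniform_objective i n_h n_n d (a b) m in
        unique (maximizes feas_D obj_D) (0, Lambda / i) /\
        unique (maximizes feas_U obj_U) (Lambda / (2 * i)) /\
        (exists v, is_max_value feas_D obj_D v /\ v / m = G_D b) /\
        (exists v, is_max_value feas_U obj_U v /\ v / m = G_U b)) /\
      (forall b, b_lo <= b -> 0 < G_U b < G_D b) /\
      exists S_D S_U : R,
        is_max_value (fun b => b_lo <= b) (fun b => G_D b / (b * ln 2)) S_D /\
        is_max_value (fun b => b_lo <= b) (fun b => G_U b / (b * ln 2)) S_U /\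
        0 < S_U < S_D /\
        (forall m, 0 < m < 1 / S_D ->
          (forall b, ~ B_D m b) /\ (forall b, ~ B_U m b)) /\
        (forall m, 1 / S_D <= m < 1 / S_U ->
          (exists b, B_D m b) /\ (forall b, ~ B_U m b)) /\
        (forall m, 1 / S_U <= m ->
          (forall b, B_U m b -> B_D m b) /\ (exists b, B_D m b /\ ~ B_U m b)).
Proof.
  intros d c_h c_n C delta a.
  assert (hd : 0 < d) by (unfold d; lra).
  destruct (lot_cost_surjective z hz w_N) as [b0 [hb0 hcost]]; [lra|].
  assert (ha_mono : forall b b', 0 < b -> b <= b' -> a b <= a b').
  { intros b b' hb [hlt| ->]; [|lra].
    pose proof (lot_cost_decreasing z hz b b' hb hlt).
    unfold a, noise_margin. lra. }
  exists b0. split; [|split].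
  - split; [split; assumption|]. intros b [hb hbc].
    destruct (Rtotal_order b0 b) as [hlt|[heq|hlt]]; [|assumption|].
    + pose proof (lot_cost_decreasing z hz b0 b hb0 hlt). lra.
    + pose proof (lot_cost_decreasing z hz b b0 hb hlt). lra.
  - intros b hb. pose proof (lot_cost_decreasing z hz b0 b hb0 hb).
    unfold a, noise_margin. lra.
  - intros b_lo Lambda hb_lo hLambda hcap G_D G_U B_D B_U.
    set (L := Lambda / i) in *.
    assert (hL : 0 < L) by (apply Rdiv_lt_0_compat; assumption).
    assert (hLi : Lambda = i * L) by (unfold L; field; lra).
    assert (hL2 : Lambda / (2 * i) = L / 2) by (unfold L; field; lra).
    (* The cap is imposed at [b_lo] only; it carries over to larger [b] because [a] increases. *)
    assert (hLa : forall b, b_lo <= b -> 2 * (i + n_n) * L < (n_n - n_h) * a b).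
    { intros b hb. specialize (ha_mono b_lo b ltac:(lra) hb).
      apply Rlt_le_trans with ((n_n - n_h) * a b_lo);
        [|apply Rmult_le_compat_l; lra].
      apply (Rmult_lt_compat_l (2 * (i + n_n) / i)) in hcap;
        [|apply Rdiv_lt_0_compat; lra].
      replace (2 * (i + n_n) / i * Lambda) with (2 * (i + n_n) * L) in hcap
        by (unfold L; field; lra).
      replace (2 * (i + n_n) / i * (delta * a b_lo))
        with ((n_n - n_h) * a b_lo) in hcap by (unfold delta; field; lra).
      assumption. }
    assert (hhalf : forall b, b_lo <= b -> 2 * L < a b).
    { intros b hb. specialize (hLa b hb).
      apply (levy_cap_below_half i n_h n_n); assumption. }
    assert (hGU : forall b, G_U b = d * Lambda + C * (L / 2) * (a b - L / 2)).
    { intro b. unfold G_U. rewrite hL2. reflexivity. }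
    assert (hUD : forall b, b_lo <= b -> 0 < G_U b < G_D b).
    { intros b hb. specialize (hLa b hb). specialize (hhalf b hb).
      rewrite hGU. unfold G_D, C, c_h, c_n. fold L. split.
      - assert (0 < d * Lambda) by (apply Rmult_lt_0_compat; assumption).
        assert (0 < (i + n_h + (i + n_n)) * (L / 2) * (a b - L / 2))
          by (apply Rmult_lt_0_compat; [apply Rmult_lt_0_compat|]; lra).
        lra.
      (* This product is twice [G_D b - G_U b]. *)
      - assert (0 < L * ((n_n - n_h) * a b - 2 * (i + n_n) * L
                         + (2 * i + n_h + n_n) * L / 2)).
        { apply Rmult_lt_0_compat; [assumption|].
          assert (0 < (2 * i + n_h + n_n) * L) by (apply Rmult_lt_0_compat; lra).
          lra. }
        lra. }
    split; [|split].
    + intros m b hm hb feas_D obj_D feas_U obj_U.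
      specialize (hLa b hb). specialize (hhalf b hb).
      rewrite hL2.
      assert (hD : unique (maximizes feas_D obj_D) (0, L)).
      { apply unique_maximizer.
        - unfold feas_D, directional_feasible. simpl. lra.
        - intros [x y] [hxy [hx hy]]. simpl in hxy, hx, hy.
          apply (directional_revenue_lt i n_h n_n d (a b) m L); try assumption;
            try lra.
          apply (Rmult_le_reg_l i); lra. }
      assert (hU : unique (maximizes feas_U obj_U) (L / 2)).
      { apply unique_maximizer.
        - unfold feas_U, uniform_feasible. lra.
        - intros l [hl hla].
          apply (uniform_revenue_lt i n_h n_n d (a b) m L); try assumption;
            try lra.
          apply (Rmult_le_reg_l i); lra. }
      repeat split; try apply hD; try apply hU.
      * exists (obj_D (0, L)). split; [exists (0, L); split; [apply hD|reflexivity]|].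
        unfold obj_D, directional_objective, G_D, c_n. simpl. fold L.
        rewrite levy_revenue_split, hLi. field. lra.
      * exists (obj_U (L / 2)). split; [exists (L / 2); split; [apply hU|reflexivity]|].
        unfold obj_U, uniform_objective. rewrite hGU. unfold C, c_h, c_n.
        rewrite levy_revenue_split, hLi. field. lra.
    + assumption.
    (* The bound on [G_D] comes from [a b <= w_N], as the lot cost is positive. *)
    + apply (funding_thresholds G_D G_U b_lo (d * Lambda + c_n * L * w_N)).
      * lra.
      * intros b hb. apply affine_continuous, noise_margin_continuous; lra.
      * intros b hb. apply affine_continuous, noise_margin_continuous; lra.
      * assumption.
      * intros b hb. unfold G_D. fold L.
        pose proof (lot_cost_pos z hz b ltac:(lra)).
        apply Rplus_le_compat_l, Rmult_le_compat_l.
        -- unfold c_n. apply Rmult_le_pos; lra.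
        -- unfold a, noise_margin. lra.
Qed.
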